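(* Let $\mathbf v(\mathbf x,t)$ be a smooth incompressible velocity field with flow map $\mathbf F_{t_0}^t$, and let $\mathbf D(\mathbf x,t)$ be a symmetric positive definite diffusion-structure tensor on $\mathbb{R}^n$. Consider an observer change $$\mathbf x=\mathbf Q(t)\mathbf y+\mathbf b(t),\qquad\mathbf Q(t_0)=\mathbf I,$$ with $\mathbf Q(t)$ a smooth family of rotations and $\mathbf b(t)\in\mathbb{R}^n$ smooth, under which the diffusion-structure tensor transforms as $\tilde{\mathbf D}(\mathbf y,t)=\mathbf Q^\top(t)\mathbf D(\mathbf x,t)\mathbf Q(t)$. Let $\tilde{\mathbf F}_{t_0}^t$ be the flow map in the $\mathbf y$-frame, and let $\tilde{\mathbf T}_{t_0}^t$ and $\bar{\tilde{\mathbf T}}{}_{t_0}^{t_1}$ be the tensors computed from $\tilde{\mathbf F}_{t_0}^t$ and $\tilde{\mathbf D}$ by the same formulas that give $\mathbf T_{t_0}^t$ and $\bar{\mathbf T}_{t_0}^{t_1}$ from $\mathbf F_{t_0}^t$ and $\mathbf D$. Then, for $\mathbf x_0=\mathbf y_0+\mathbf b(t_0)$, $$\mathbf T_{t_0}^t(\mathbf x_0)=\tilde{\mathbf T}_{t_0}^t(\mathbf y_0)\quad\text{for all }t\in[t_0,t_1],\qquad \bar{\mathbf T}_{t_0}^{t_1}(\mathbf x_0)=\bar{\tilde{\mathbf T}}{}_{t_0}^{t_1}(\mathbf y_0).$$ Consequently the transport functional is also frame-indifferent: its value on $\mathcal M_0$ in the $\mathbf x$-frame equals its value on the corresponding surface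 $\mathcal M_0-\mathbf b(t_0)$ in the $\mathbf y$-frame.
   Context: The flow map $\mathbf F_{t_0}^t$ sends the initial position $\mathbf x_0$ at time $t_0$ to the position at time $t$ of the trajectory of $\dot{\mathbf x}=\mathbf v(\mathbf x,t)$; $\tilde{\mathbf F}_{t_0}^t$ sends $\mathbf y_0$ to the $\mathbf y$-frame position at time $t$ of the same material point, i.e. $\mathbf F_{t_0}^t(\mathbf x_0)=\mathbf Q(t)\tilde{\mathbf F}_{t_0}^t(\mathbf y_0)+\mathbf b(t)$. $\nabla_0$ is the gradient with respect to initial positions. The tensors are $$\mathbf T_{t_0}^t(\mathbf x_0)=\left[\nabla_0\mathbf F_{t_0}^t(\mathbf x_0)\right]^{-1}\mathbf D\left(\mathbf F_{t_0}^t(\mathbf x_0),t\right)\left[\nabla_0\mathbf F_{t_0}^t(\mathbf x_0)\right]^{-\top},\qquad \bar{\mathbf T}_{t_0}^{t_1}=\frac1{t_1-t_0}\int_{t_0}^{t_1}\mathbf T_{t_0}^t\,dt,$$ and the transport functional of an $(n-1)$-dimensional hypersurface $\mathcal M_0$ with unit normal $\mathbf n_0$ and area element $dA_0$ is $$\mathcal T_{t_0}^{t_1}(\mathcal M_0)=\frac{\int_{\mathcal M_0}\left\langle\mathbf n_0,\bar{\mathbf T}_{t_0}^{t_1}\mathbf n_0\right\rangle dA_0}{\int_{\mathcal M_0}dA_0}.$$ *)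

(* Defs.v *)
From HB Require Import structures.
From mathcomp Require Import all_boot all_order all_algebra.
From mathcomp Require Import all_classical all_reals all_analysis.

Set Implicit Arguments.
Unset Strict Implicit.
Unset Printing Implicit Defensive.

Import Order.TTheory GRing.Theory Num.Theory.
Import numFieldNormedType.Exports.

Local Open Scope classical_set_scope.
Local Open Scope ring_scope.

(** Vectors of R^n are columns. The norm that the library puts on matrices is
    the sup norm; it is used only for topology and differentiation. Lengths and
    diameters are the Euclidean ones below. *)
Section Euclidean.
Context {R : realType} {n : nat}.

Definition dotv (u w : 'cV[R]_n) : R := (u^T *m w) 0 0.

Definition enorm (u : 'cV[R]_n) : R := Num.sqrt (dotv u u).

Definition sym_posdef (A : 'M[R]_n) : Prop :=
  A^T = A /\ forall u : 'cV[R]_n, u != 0 -> 0 < dotv u (A *m u).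

Definition rotation (A : 'M[R]_n) : Prop := A^T *m A = 1%:M /\ \det A = 1.

End Euclidean.

(** For finite-dimensional V this is the usual class C^k: by induction on k, all
    partial derivatives up to order k exist and are continuous. *)
Fixpoint Ck {R : realType} {V W : normedModType R} (k : nat) (f : V -> W)
    {struct k} : Prop :=
  match k with
  | 0 => continuous f
  | k'.+1 => (forall x, differentiable f x) /\ forall u : V, Ck k' ('D_u f)
  end.

Definition smooth {R : realType} {V W : normedModType R} (f : V -> W) : Prop :=
  forall k, Ck k f.

Section Calculus.
Context {R : realType} {n : nat}.
Local Notation V := 'cV[R]_n.

Definition grad (g : V -> R) (x : V) : V := \col_i 'D_(delta_mx i 0) g x.

(* [gradmx f x] has the entry d f_i / d x_j in row i and column j. *)
Definition gradmx (f : V -> V) (x : V) : 'M[R]_n :=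
  \matrix_(i, j) ('D_(delta_mx j 0) f x) i 0.

Definition divergence (f : V -> V) (x : V) : R := \tr (gradmx f x).

End Calculus.

Section Flow.
Context {R : realType} {n : nat}.
Local Notation V := 'cV[R]_n.

(* [F t x0] is the position at time t of the trajectory starting at x0 at time
   t0. The ODE is imposed at interior times; with continuity up to the end
   points and continuity of v it gives the one-sided derivatives at t0, t1. *)
Definition flow_map (v : V -> R -> V) (t0 t1 : R) (F : R -> V -> V) : Prop :=
  forall x0 : V,
    [/\ F t0 x0 = x0,
        {within `[t0, t1], continuous (fun t => F t x0)} &
        forall t, t \in `]t0, t1[ ->
          is_derive t (1 : R) (fun s => F s x0) (v (F t x0) t)].

Definition transport_tensor (F : R -> V -> V) (D : V -> R -> 'M[R]_n)
    (t : R) (x0 : V) : 'M[R]_n :=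
  invmx (gradmx (F t) x0) *m D (F t x0) t *m (invmx (gradmx (F t) x0))^T.

Definition avg_transport_tensor (F : R -> V -> V) (D : V -> R -> 'M[R]_n)
    (t0 t1 : R) (x0 : V) : 'M[R]_n :=
  (t1 - t0)^-1 *:
    \matrix_(i, j) \int[lebesgue_measure]_(t in `[t0, t1])
                     transport_tensor F D t x0 i j.

End Flow.

(* Volume of the Euclidean unit ball of R^m. *)
Fixpoint unit_ball_volume {R : realType} (m : nat) : R :=
  match m with
  | 0 => 1
  | 1 => 2
  | (k.+1 as k').+1 => 2 * pi / k'.+1%:R * unit_ball_volume k
  end.

(** m-dimensional Hausdorff measure, normalised so that it is the
    m-dimensional area on m-dimensional C^1 submanifolds of R^n. *)
Section Hausdorff.
Context {R : realType} {n : nat}.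
Local Notation V := 'cV[R]_n.
Local Open Scope ereal_scope.

Definition ediam (U : set V) : \bar R :=
  ereal_sup [set (enorm (p.1 - p.2))%:E | p in U `*` U].

(* The empty set is singled out because it must have gauge 0 also for m = 0,
   where nonempty sets have gauge 1. *)
Definition hausdorff_gauge (m : nat) (U : set V) : \bar R :=
  if `[< U = set0 >] then 0
  else (unit_ball_volume m / 2 ^+ m)%:E * ediam U ^+ m.

Definition hausdorff_pre (m : nat) (delta : R) (A : set V) : \bar R :=
  ereal_inf [set \sum_(k <oo) hausdorff_gauge m (U k) | U in
    [set U : (set V)^nat |
      A `<=` \bigcup_k U k /\ forall k, ediam (U k) <= delta%:E]].

Definition hausdorff (m : nat) (A : set V) : \bar R :=
  ereal_sup [set hausdorff_pre m delta A | delta in [set d : R | (0 < d)%R]].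

End Hausdorff.

(** The Hausdorff outer measure, and the measure that Caratheodory's theorem
    extracts from it. *)
Section HausdorffMeasure.
Context {R : realType} {n : nat}.
Local Notation V := 'cV[R]_n.
Local Open Scope ereal_scope.

Lemma unit_ball_volume_ge0 m : (0 <= unit_ball_volume m :> R)%R.
Proof.
suff /(_ m)[] : forall k,
  (0 <= unit_ball_volume k :> R)%R /\ (0 <= unit_ball_volume k.+1 :> R)%R by [].
elim=> [|k [k0 k1]]; first by split => /=.
split=> //; apply: mulr_ge0 => //.
by rewrite divr_ge0// mulr_ge0// pi_ge0.
Qed.

Lemma ediam_ge0 (U : set V) : U <> set0 -> 0 <= ediam U.
Proof.
move=> /eqP/set0P[x Ux]; apply: ereal_sup_ubound; exists (x, x) => //=.
by rewrite subrr /enorm /dotv mulmx0 mxE sqrtr0.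
Qed.

Lemma hausdorff_gauge_ge0 m (U : set V) : 0 <= hausdorff_gauge m U.
Proof.
rewrite /hausdorff_gauge; case: asboolP => // /ediam_ge0 U0.
by rewrite mule_ge0 ?expe_ge0// lee_fin divr_ge0 ?unit_ball_volume_ge0.
Qed.

(* The library's outer measure construction [mu_ext] applies once all sets are
   declared measurable and sets of diameter > delta are given measure +oo. *)
Let P : measurableType _ := g_sigma_algebraType [set: set V].

Let cut_gauge m (delta : R) (U : set P) : \bar R :=
  if `[< U = set0 >] then 0
  else if ediam (U : set V) <= delta%:E then hausdorff_gauge m (U : set V)
  else +oo.

Let cut_gauge0 m delta : cut_gauge m delta set0 = 0.
Proof. by rewrite /cut_gauge asboolT. Qed.

Let cut_gauge_ge0 m delta U : 0 <= cut_gauge m delta U.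
Proof.
rewrite /cut_gauge; case: ifP => // _; case: ifP => // _.
exact: hausdorff_gauge_ge0.
Qed.

Let ediam0 : ediam (set0 : set V) = -oo.
Proof. by rewrite /ediam set0X image_set0 ereal_sup0. Qed.

Let hausdorff_preE m delta (A : set V) :
  hausdorff_pre m delta A = mu_ext (cut_gauge m delta) (A : set P).
Proof.
apply/eqP; rewrite eq_le; apply/andP; split.
- apply: le_ereal_inf_tmp => _ [U [_ AU] <-].
  have [dU|] := pselect (forall k, ediam (U k : set V) <= delta%:E).
    apply: ereal_inf_lbound; exists U => //.
    apply: eq_eseriesr => k _; rewrite /cut_gauge dU.
    by case: asboolP => //; rewrite /hausdorff_gauge => /asboolT ->.
  move=> /existsNP[k /negP dUk].
  rewrite (@eseries_pinfty _ _ _ k) ?leey//.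
    by move=> i _; rewrite -ltNye (lt_le_trans _ (cut_gauge_ge0 _ _ _)).
  rewrite /cut_gauge (negbTE dUk); case: asboolP => // U0.
  by move: dUk; rewrite U0 ediam0 leNye.
- apply: le_ereal_inf_tmp => _ [U [AU dU] <-].
  apply: ereal_inf_lbound; exists U.
    by split=> // i; exact: sub_gen_smallest.
  apply: eq_eseriesr => k _; rewrite /cut_gauge dU.
  by case: asboolP => //; rewrite /hausdorff_gauge => /asboolT ->.
Qed.

Lemma hausdorff_pre_le m delta (A : set V) : (0 < delta)%R ->
  hausdorff_pre m delta A <= hausdorff m A.
Proof. by move=> d0; apply: ereal_sup_ubound; exists delta. Qed.

Lemma hausdorff_ge0 m (A : set V) : 0 <= hausdorff m A.
Proof.
apply: (le_trans _ (@hausdorff_pre_le _ 1%R _ _)) => //.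
by rewrite hausdorff_preE mu_ext_ge0.
Qed.

Lemma hausdorff0 m : hausdorff m (set0 : set V) = 0.
Proof.
apply/eqP; rewrite eq_le hausdorff_ge0 andbT.
apply: ge_ereal_sup => _ [d d0 <-].
by rewrite hausdorff_preE mu_ext0.
Qed.

Lemma le_hausdorff m : {homo @hausdorff R n m : A B / A `<=` B >-> A <= B}.
Proof.
move=> A B AB; apply: ge_ereal_sup => _ [d d0 <-].
apply: le_trans (hausdorff_pre_le _ _ d0).
by rewrite !hausdorff_preE; exact: le_mu_ext.
Qed.

Lemma hausdorff_sigma_subadditive m : sigma_subadditive (@hausdorff R n m).
Proof.
move=> A; apply: ge_ereal_sup => _ [d d0 <-].
rewrite hausdorff_preE.
apply: le_trans (mu_ext_sigma_subadditive (cut_gauge_ge0 m d) A) _.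
apply: lee_nneseries => [i _ _|i _]; first exact: mu_ext_ge0.
by rewrite -hausdorff_preE hausdorff_pre_le.
Qed.

HB.instance Definition _ m := isOuterMeasure.Build R V (@hausdorff R n m)
  (hausdorff0 m) (@hausdorff_ge0 m) (@le_hausdorff m)
  (@hausdorff_sigma_subadditive m).

Definition area_outer : {outer_measure set V -> \bar R} := @hausdorff R n n.-1.

(* Surface area. The Caratheodory sigma-algebra on which it is a measure contains
   the Borel sets, since [hausdorff m] is a metric outer measure. *)
Definition area_measure :
    {measure set (caratheodory_type area_outer) -> \bar R} := area_outer.

End HausdorffMeasure.

Section Hypersurface.
Context {R : realType} {n : nat}.
Local Notation V := 'cV[R]_n.

(* Near p, M is the regular zero set of g, or the half of it cut out by 0 <= h
   in case p lies on the boundary of M; at interior points one may take h = 1. *)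
Definition defining_function (M : set V) (p : V) (g : V -> R) : Prop :=
  [/\ Ck 1 g, grad g p != 0 &
      exists h : V -> R,
        [/\ Ck 1 h,
            h p = 0 -> forall c : R, grad h p != c *: grad g p &
            \forall x \near p, M x <-> g x = 0 /\ 0 <= h x]].

(** Embedded (n-1)-dimensional C^1 hypersurfaces, possibly with boundary. *)
Definition hypersurface (M : set V) : Prop :=
  forall p, M p -> exists g, defining_function M p g.

(* No continuity is asked of the field of unit normals, so that M need not be
   orientable. *)
Definition unit_normal (M : set V) (nu : V -> V) : Prop :=
  forall p, M p -> enorm (nu p) = 1 /\
    forall g, defining_function M p g -> exists c : R, nu p = c *: grad g p.

Definition transport_functional (F : R -> V -> V) (D : V -> R -> 'M[R]_n)
    (t0 t1 : R) (M : set V) (nu : V -> V) : R :=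
  (\int[area_measure]_(x in M)
     dotv (nu x) (avg_transport_tensor F D t0 t1 x *m nu x)) /
  (\int[area_measure]_(x in M) 1).

End Hypersurface.

(* Main.v *)
Require Import Defs.
From HB Require Import structures.
From mathcomp Require Import all_boot all_order all_algebra.
From mathcomp Require Import all_classical all_reals all_analysis.
From mathcomp Require Import ring lra.

Set Implicit Arguments.
Unset Strict Implicit.
Unset Printing Implicit Defensive.

Import Order.TTheory GRing.Theory Num.Theory.
Import numFieldNormedType.Exports.

Local Open Scope classical_set_scope.
Local Open Scope ring_scope.

(** Both flow maps are conjugate, F_t(x) = Q(t) Fy_t(x - b(t0)) + b(t), so the
    deformation gradients satisfy grad F = Q grad Fy, and the rotations cancel
    in the tensor T as soon as grad F is invertible. Regularity of the flow map
    is not assumed and has to be derived from the smoothness of v: a linear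
    combination u(t) of difference quotients of F_t in the initial point
    satisfies u' = A u + o(1), where A is the spatial Jacobian of v along the
    base trajectory, and a Gronwall estimate valid in both time directions
    bounds |u(s)| by |u(t)| up to o(1) for all s, t. With u(t0) = 0 it says
    that difference quotients are Cauchy, so the derivatives exist; with
    u(t0) <> 0 it says that the derivatives along the basis vectors are
    linearly independent.

    For the functional, the Hausdorff measure is translation invariant, and at
    each point both unit normals are multiples of one gradient, hence agree up
    to a sign, which the quadratic form does not see. *)

(** * Gronwall estimates *)

(** The bound on the absolute value of the derivative controls growth and decay alike. The shift by
    [c / L] turns [L * f t + c] into [L * (f t + c / L)], so the shifted function times
    [expR (L * t)] is nondecreasing, and times [expR (- L * t)] it is nonincreasing. Together they
    compare any two times, in either order. *)
Lemma gronwall_two_sided (R : realType) (f : R -> R) (a b L c : R) :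
  0 < L -> 0 <= c -> (forall t, 0 <= f t) ->
  {within `[a, b], continuous f} ->
  (forall t, t \in `]a, b[ -> derivable f t 1) ->
  (forall t, t \in `]a, b[ -> `|'D_1 f t| <= L * f t + c) ->
  forall s t, s \in `[a, b] -> t \in `[a, b] ->
  f s <= expR (L * (b - a)) * (f t + c / L).
Proof.
move=> L0 c0 f0 cf df fle.
have k0 : 0 <= c / L by rewrite divr_ge0// ltW.
pose g (m : R) := ((fun x => f x + c / L) * (fun x => expR (m * x)) : R -> R).
have cg m : {within `[a, b], continuous (g m)}.
  move=> x; apply: (@continuousM _ (subspace `[a, b])).
    apply: (@continuousD _ _ (subspace `[a, b])); first exact: cf.
    exact: cst_continuous.
  apply: continuous_comp; last exact: continuous_expR.
  apply: (@continuousM _ (subspace `[a, b])); first exact: cst_continuous.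
  by apply: continuous_subspaceT => y; exact: cvg_id.
have dg m t : t \in `]a, b[ ->
    is_derive t 1 (g m) (expR (m * t) * ('D_1 f t + m * (f t + c / L))).
  move=> tab; have dft := derivableP (df t tab).
  have d1 : is_derive t 1 (fun x => f x + c / L) ('D_1 f t).
    have := is_deriveD dft (is_derive_cst (c / L) t 1).
    by rewrite addr0.
  have d2 : is_derive t 1 (fun x => expR (m * x)) (expR (m * t) * m).
    apply: (@is_derive1_comp _ expR ( *%R m)).
    have := is_deriveZ m (is_derive_id t (1 : R)).
    by rewrite /GRing.scale /= mulr1.
  apply: is_derive_eq (is_deriveM d1 d2) _.
  by rewrite /GRing.scale /=; ring.
have kE t : L * f t + c = L * (f t + c / L).
  by rewrite mulrDr mulrCA divff ?mulr1// gt_eqF.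
have main s t : s \in `[a, b] -> t \in `[a, b] -> s <= t ->
    f s + c / L <= expR (L * (t - s)) * (f t + c / L) /\
    f t + c / L <= expR (L * (t - s)) * (f s + c / L).
  move=> sab tab st; split.
    have : g L s <= g L t.
      apply: (ger0_derive1_le_cc _ _ (cg L)) => // x xab.
        by have [] := dg L _ xab.
      rewrite derive1E (@derive_val _ _ _ _ _ _ _ (dg L x xab)).
      rewrite mulr_ge0 ?expR_ge0// -kE//.
      by have := fle x xab; rewrite ler_norml => /andP[]; lra.
    rewrite /g /GRing.mul/= => H.
    have : (f s + c / L) * expR (L * s) * expR (- (L * s)) <=
           (f t + c / L) * expR (L * t) * expR (- (L * s)).
      by rewrite ler_wpM2r ?expR_ge0.
    by rewrite -!mulrA -!expRD subrr expR0 mulr1 -mulrBr [leRHS]mulrC.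
  have : g (- L) t <= g (- L) s.
    apply: (ler0_derive1_le_cc _ _ (cg (- L))) => // x xab.
      by have [] := dg (- L) _ xab.
    rewrite derive1E (@derive_val _ _ _ _ _ _ _ (dg (- L) x xab)).
    rewrite mulr_ge0_le0 ?expR_ge0// mulNr -kE//.
    by have := fle x xab; rewrite ler_norml => /andP[]; lra.
  rewrite /g /GRing.mul/= => H.
  have : (f t + c / L) * expR (- L * t) * expR (L * t) <=
         (f s + c / L) * expR (- L * s) * expR (L * t).
    by rewrite ler_wpM2r ?expR_ge0.
  rewrite -!mulrA -!expRD !mulNr addNr expR0 mulr1 [- _ + _]addrC -mulrBr.
  by rewrite [leRHS]mulrC.
have wk s t : s \in `[a, b] -> t \in `[a, b] -> `|s - t| <= b - a.
  rewrite !in_itv/= ler_norml => /andP[? ?] /andP[? ?].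
  by apply/andP; split; lra.
(* The exponent is enlarged to the full length [b - a] and [c / L] is dropped on the left, which
   makes the bound uniform in both times. *)
have fin s t r : r <= b - a ->
    f s + c / L <= expR (L * r) * (f t + c / L) ->
    f s <= expR (L * (b - a)) * (f t + c / L).
  move=> rba H; apply: le_trans (_ : f s + c / L <= _); first by rewrite lerDl.
  apply: (le_trans H); rewrite ler_wpM2r ?addr_ge0// ler_expR ler_wpM2l//.
  exact: ltW.
move=> s t sab tab; have [st|/ltW ts] := leP s t.
  apply: (fin s t (t - s)); last by have [] := main s t sab tab st.
  by apply: le_trans (wk t s tab sab); exact: ler_norm.
apply: (fin s t (s - t)); last by have [] := main t s tab sab ts.
by apply: le_trans (wk s t sab tab); exact: ler_norm.
Qed.

Lemma dotvE (R : realType) n (u w : 'cV[R]_n) :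
  dotv u w = \sum_i u i 0 * w i 0.
Proof. by rewrite /dotv mxE; apply: eq_bigr => i _; rewrite mxE. Qed.

Lemma dotv_ge0 (R : realType) n (u : 'cV[R]_n) : 0 <= dotv u u.
Proof. by rewrite dotvE sumr_ge0// => i _; rewrite -expr2 sqr_ge0. Qed.

Lemma sqr_coord_le_dotv (R : realType) n (u : 'cV[R]_n) i :
  u i 0 ^+ 2 <= dotv u u.
Proof.
rewrite dotvE (bigD1 i)//= expr2 lerDl sumr_ge0// => j _.
by rewrite -expr2 sqr_ge0.
Qed.

Lemma coord_le_norm (R : realType) n (u : 'cV[R]_n) i : `|u i 0| <= `|u|.
Proof. by rewrite {2}/Num.norm/= mx_normrE; exact: (le_bigmax _ _ (i, 0)). Qed.

(** Passes from the Euclidean energy, on which Gronwall acts, to the sup norm used for limits and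
    for the linearisation radius. *)
Lemma norm_le_of_dotv (R : realType) n (u : 'cV[R]_n) r :
  0 <= r -> dotv u u <= r ^+ 2 -> `|u| <= r.
Proof.
move=> r0 ur; rewrite /Num.norm/= mx_normrE; apply: bigmax_le => // -[i j] _ /=.
rewrite ord1 -ler_sqr ?nnegrE// real_normK ?num_real//.
exact: le_trans (sqr_coord_le_dotv _ _) ur.
Qed.

Lemma dotvZ (R : realType) n (k : R) (u : 'cV[R]_n) :
  dotv (k *: u) (k *: u) = k ^+ 2 * dotv u u.
Proof.
by rewrite !dotvE mulr_sumr; apply: eq_bigr => i _; rewrite !mxE; ring.
Qed.

Lemma dotv_continuous (R : realType) n :
  continuous (fun u : 'cV[R]_n => dotv u u).
Proof.
rewrite (_ : (fun _ => _) = fun u : 'cV[R]_n => \sum_i u i 0 * u i 0); last first.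
  by apply/funext => w; exact: dotvE.
apply: continuous_big => [|i _ w]; first exact: add_continuous.
by apply: continuousM; exact: coord_continuous.
Qed.

Lemma is_derive_coord (R : realType) m n (u : R -> 'M[R]_(m, n)) t du i j :
  is_derive t (1 : R) u du -> is_derive t (1 : R) (fun s => u s i j) (du i j).
Proof.
move=> [dut <-]; have dij := (derivable_mxP u t 1).1 dut i j.
by apply: DeriveDef => //; rewrite derive_mx// mxE.
Qed.

Lemma is_derive_dotv (R : realType) n (u : R -> 'cV[R]_n) t du :
  is_derive t (1 : R) u du ->
  is_derive t (1 : R) (fun s => dotv (u s) (u s)) (2 * dotv (u t) du).
Proof.
move=> d; pose h i := ((fun s => u s i 0) * (fun s => u s i 0) : R -> R).
rewrite (_ : (fun _ => _) = \sum_i h i); last first.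
  by apply/funext => s; rewrite dotvE fct_sumE.
have dh i : is_derive t (1 : R) (h i) (2 * (u t i 0 * du i 0)).
  have di := is_derive_coord i 0 d.
  apply: is_derive_eq (is_deriveM di di) _.
  by rewrite /GRing.scale/=; ring.
apply: is_derive_eq (is_derive_sum dh) _.
by rewrite dotvE mulr_sumr.
Qed.

(* Young: [2 x (A u)_i] and [2 x e_i] are absorbed by squares, which costs the
   additive 1 in the Gronwall constant. *)
Lemma quadratic_growth (R : realType) n (A : 'M[R]_n) (u e : 'cV[R]_n) M eps :
  0 <= eps ->
  (forall i j, `|A i j| <= M) -> (forall i, `|e i 0| <= eps) ->
  `|2 * dotv u (A *m u + e)| <=
    (2 * n%:R * M + 1) * dotv u u + n%:R * eps ^+ 2.
Proof.
move=> eps0 AM ee.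
have {1}-> : 2 * dotv u (A *m u + e) =
    \sum_i (\sum_j (2 * (u i 0 * (A i j * u j 0))) + 2 * (u i 0 * e i 0)).
  rewrite dotvE mulr_sumr; apply: eq_bigr => i _.
  by rewrite !mxE -!mulr_sumr; ring.
apply: le_trans (ler_norm_sum _ _ _) _.
apply: (@le_trans _ _ (\sum_i (\sum_j M * (u i 0 ^+ 2 + u j 0 ^+ 2) +
   (u i 0 ^+ 2 + eps ^+ 2)))).
  apply: ler_sum => i _; apply: le_trans (ler_normD _ _) _; apply: lerD.
    apply: le_trans (ler_norm_sum _ _ _) _; apply: ler_sum => j _.
    have -> : 2 * (u i 0 * (A i j * u j 0)) = A i j * (2 * (u i 0 * u j 0)).
      by ring.
    rewrite normrM; apply: ler_pM => //.
    have := sqr_ge0 (u i 0 - u j 0); have := sqr_ge0 (u i 0 + u j 0).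
    by rewrite ler_norml => ? ?; apply/andP; split; nra.
  have := ee i; rewrite !ler_norml => /andP[e1 e2].
  have := sqr_ge0 (u i 0 - e i 0); have := sqr_ge0 (u i 0 + e i 0).
  by move=> ? ?; apply/andP; split; nra.
have -> : dotv u u = \sum_i u i 0 ^+ 2.
  by rewrite dotvE; apply: eq_bigr => i _; rewrite expr2.
rewrite !big_split/=.
have E1 : \sum_i \sum_(j < n) M * (u i 0 ^+ 2 + u j 0 ^+ 2) =
    2 * n%:R * M * (\sum_i u i 0 ^+ 2).
  under eq_bigr do rewrite -mulr_sumr big_split/= sumr_const card_ord.
  rewrite -mulr_sumr big_split/= sumr_const card_ord.
  by rewrite sumrMnl -mulr_natl; ring.
rewrite E1 sumr_const card_ord -mulr_natl.
by lra.
Qed.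

(** Gronwall is applied to the squared Euclidean length of [u], which is differentiable even where
    [u] vanishes. *)
Lemma energy_estimate (R : realType) n (a b : R) (u : R -> 'cV[R]_n)
    (A : R -> 'M[R]_n) (e : R -> 'cV[R]_n) M eps :
  0 <= M -> 0 <= eps ->
  {within `[a, b], continuous u} ->
  (forall t, t \in `]a, b[ -> is_derive t (1 : R) u (A t *m u t + e t)) ->
  (forall t i j, t \in `]a, b[ -> `|A t i j| <= M) ->
  (forall t i, t \in `]a, b[ -> `|e t i 0| <= eps) ->
  forall s t, s \in `[a, b] -> t \in `[a, b] ->
  dotv (u s) (u s) <= expR ((2 * n%:R * M + 1) * (b - a)) *
                      (dotv (u t) (u t) + n%:R * eps ^+ 2).
Proof.
move=> M0 e0 cu du AM ee s t sab tab.
have L1 : 1 <= 2 * n%:R * M + 1 by rewrite lerDr !mulr_ge0.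
have c0 : 0 <= n%:R * eps ^+ 2 by rewrite mulr_ge0 ?sqr_ge0.
apply: le_trans
  (@gronwall_two_sided _ (fun t => dotv (u t) (u t)) a b
     (2 * n%:R * M + 1) (n%:R * eps ^+ 2) _ c0 _ _ _ _ s t sab tab) _.
- exact: lt_le_trans L1.
- by move=> ?; exact: dotv_ge0.
- move=> x; apply: (@continuous_comp (subspace `[a, b]) _ _ u
     (fun w : 'cV[R]_n => dotv w w)); first exact: cu.
  exact: dotv_continuous.
- by move=> x xab; have [] := is_derive_dotv (du x xab).
- move=> x xab; have d := is_derive_dotv (du x xab).
  rewrite derive_val; apply: quadratic_growth => // *.
    exact: AM.
  exact: ee.
(* The Gronwall rate is at least 1, so dividing the additive term by it only decreases that term. *)
rewrite ler_wpM2l ?expR_ge0// lerD2l ler_pdivrMr ?(lt_le_trans _ L1)//.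
by rewrite ler_peMr.
Qed.

(** * Linearisation along a trajectory *)

(** Only [p] is confined to the compact set; [q] is free, because perturbed trajectories leave the
    base one. Near each point of [K] half the local radius works, and compactness makes one [del]
    serve all of [K]. *)
Lemma compact_uniform_continuity (R : realType) (T W : normedModType R)
    (K : set T) (g : T -> W) (eps : R) :
  compact K -> continuous g -> 0 < eps ->
  \forall del \near 0^'+, forall p q, K p -> `|p - q| <= del ->
    `|g p - g q| <= eps.
Proof.
move=> /compact_near_coveringP cK cg e0.
have : \forall del \near (0 : R)^'+,
    K `<=` (fun p => forall q, `|p - q| <= del -> `|g p - g q| <= eps).
  apply: cK => p Kp.
  have e20 : 0 < eps / 2 by rewrite divr_gt0.
  have /nbhs_normP[r /= r0 rp] : \forall q \near p, `|g p - g q| <= eps / 2.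
    by have /cvgrPdist_le /(_ _ e20) := cg p.
  have r20 : 0 < r / 2 by rewrite divr_gt0.
  near=> p' del => q p'q.
  have pp' : `|p - p'| < r / 2.
    by near: p'; apply/nbhs_normP; exists (r / 2).
  have dr : del < r / 2 by near: del; exact: nbhs_right_lt.
  have pq : `|p - q| < r.
    apply: le_lt_trans (ler_distD p' _ _) _.
    by rewrite (splitr r) ltrD// (le_lt_trans p'q).
  apply: le_trans (ler_distD (g p) _ _) _; rewrite distrC.
  have pp'r : `|p - p'| < r by lra.
  by have := rp _ pq; have := rp _ pp'r; rewrite /=; lra.
by apply: filterS => del H p q Kp; exact: H.
Unshelve. all: by end_near. Qed.

Lemma directional_mean_value (R : realType) (U : normedModType R)
    (g : U -> R) (x d : U) :
  (forall z, differentiable g z) ->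
  exists2 s, s \in `[0, 1] & g (x + d) - g x = 'D_d g (x + s *: d).
Proof.
move=> dg; pose h (s : R) := g (x + s *: d).
have dh s : is_derive s (1 : R) h ('D_d g (x + s *: d)).
  have : derivable g (x + s *: d) d by exact: diff_derivable.
  rewrite /derivable /derive.
  (* The difference quotients of [h] at [s] are exactly those of [g] at [x + s *: d] in the
     direction [d]. *)
  rewrite (_ : (fun k => _) =
      (fun k => k^-1 *: ((h \o shift s) (k *: (1 : R)) - h s))); last first.
    apply/funext => k; rewrite /h /= [k *: 1]mulr1 scalerDl.
    by rewrite addrCA.
  by move=> H; apply: DeriveDef.
have ch : continuous h.
  by move=> s; apply/differentiable_continuous/derivable1_diffP; case: (dh s).
have [s s01] := @MVT_segment _ h _ 0 1 ler01 (fun s _ => dh s)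
  (continuous_subspaceT ch).
by rewrite /h scale1r scale0r addr0 subr0 mulr1 => E; exists s.
Qed.

Section Linearization.
Context {R : realType} {n : nat}.
Local Notation V := 'cV[R]_n.
Variable v : V -> R -> V.
Let v2 (p : V * R) := v p.1 p.2.

Definition space_jacobian (p : V * R) : 'M[R]_n :=
  \matrix_(i, j) ('D_((delta_mx j 0, 0) : V * R) v2 p) i 0.

(** The mean value theorem holds only componentwise, so each row of [B] is a row of the Jacobian at
    its own intermediate point. In return the increment of [v] is exactly linear in [d], with no
    remainder. *)
Lemma mean_value_jacobian (x d : V) (t : R) :
  (forall p, differentiable v2 p) ->
  exists B : 'M[R]_n, v (x + d) t - v x t = B *m d /\
    forall i, exists2 s, s \in `[0, 1] &
      forall j, B i j = space_jacobian (x + s *: d, t) i j.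
Proof.
move=> dv.
have dvi i (p : V * R) : differentiable (fun q => v2 q i 0) p.
  apply: (@differentiable_comp _ _ _ _ v2 (fun w : V => w i 0)) => //.
  exact: differentiable_coord.
have H i : exists2 s, s \in `[0, 1] &
    (v (x + d) t - v x t) i 0 =
    \sum_j space_jacobian (x + s *: d, t) i j * d j 0.
  have [s s01] := directional_mean_value (x, t) (d, 0) (dvi i).
  have -> : (x, t) + (d, 0) = (x + d, t) :> V * R.
    by apply/pair_equal_spec; split=> //=; rewrite addr0.
  have -> : (x, t) + s *: (d, 0) = (x + s *: d, t) :> V * R.
    by apply/pair_equal_spec; split=> //=; rewrite scaler0 addr0.
  move=> E; exists s => //.
  rewrite !mxE; move: E; rewrite /v2 /= => ->.
  rewrite deriveE//.
  (* The additive embedding of space into space-time carries the basis expansion of [d] over to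
     [(d, 0)]. *)
  pose inl0 (w : V) : V * R := (w, 0).
  have inl0D w w' : inl0 (w + w') = inl0 w + inl0 w'.
    by apply/pair_equal_spec; split=> //=; rewrite addr0.
  have -> : ((d, 0) : V * R) = \sum_j d j 0 *: inl0 (delta_mx j 0).
    rewrite -/(inl0 d) {1}(matrix_sum_delta d).
    rewrite (eq_bigr (fun j => d j 0 *: delta_mx j 0)); last first.
      by move=> j _; rewrite big_ord1.
    rewrite (big_morph inl0 inl0D (erefl _)); apply: eq_bigr => j _.
    by apply/pair_equal_spec; split=> //=; rewrite scaler0.
  rewrite linear_sum/=; apply: eq_bigr => j _.
  rewrite linearZ/= -deriveE// mxE derive_mx ?mxE; last exact: diff_derivable.
  by rewrite [RHS]mulrC.
have {H}/choice[sg sgP] i : exists s, s \in `[0, 1] /\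
    (v (x + d) t - v x t) i 0 =
    \sum_j space_jacobian (x + s *: d, t) i j * d j 0.
  by have [s s01 E] := H i; exists s.
exists (\matrix_(i, j) space_jacobian (x + sg i *: d, t) i j); split.
  apply/matrixP => i k; rewrite ord1 (sgP i).2 mxE.
  by apply: eq_bigr => j _; rewrite [in RHS]mxE.
by move=> i; exists (sg i) => [|j]; [exact: (sgP i).1|rewrite !mxE].
Qed.

(** The graph of the trajectory over [[a, b]] is compact, so the Jacobian is bounded on it and
    uniformly continuous near it. The bound [M] is chosen before [eps], so Gronwall rates built from
    it do not depend on the accuracy. *)
Lemma uniform_linearization (x : R -> V) (a b : R) :
  Ck 1 v2 -> {within `[a, b], continuous x} ->
  exists M, [/\ 0 <= M,
    (forall t i j, t \in `[a, b] -> `|space_jacobian (x t, t) i j| <= M) &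
    forall eps, 0 < eps -> \forall del \near 0^'+,
      forall t d, t \in `[a, b] -> `|d| <= del ->
      exists B : 'M[R]_n, v (x t + d) t - v (x t) t = B *m d /\
        forall i j, `|B i j - space_jacobian (x t, t) i j| <= eps].
Proof.
move=> [dv cD] cx; pose K := [set (x t, t) | t in `[a, b]] : set (V * R).
have cJ i j : continuous (fun p => space_jacobian p i j).
  rewrite (_ : (fun p => _) =
      (fun w : V => w i 0) \o ('D_((delta_mx j 0, 0) : V * R) v2)).
    move=> p; apply: continuous_comp; last exact: coord_continuous.
    exact: cD.
  by apply/funext => p; rewrite /= mxE.
have cK : compact K.
  apply: continuous_compact; last exact: segment_compact.
  have cid_ : {within `[a, b], continuous (id : R -> R)}.
    by apply: continuous_subspaceT => y; exact: cvg_id.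
  by move=> t; exact: (cvg_pair (cx t) (cid_ t)).
have Kx t : t \in `[a, b] -> K (x t, t) by move=> tab; exists t.
have bJ : \forall M \near +oo, forall i j p, K p -> `|space_jacobian p i j| <= M.
  apply: filter_forall => i; apply: filter_forall => j.
  have : bounded_set ((fun p => space_jacobian p i j) @` K).
    have cgK : compact ((fun p => space_jacobian p i j) @` K).
      exact: (continuous_compact (continuous_subspaceT (cJ i j)) cK).
    exact: (compact_bounded cgK).
  rewrite /bounded_set/bounded_near => bK.
  by apply: (filterS _ bK) => M H p Kp; apply: H; exists p.
have [M [M0 bM]] : exists M, 0 <= M /\
    forall i j p, K p -> `|space_jacobian p i j| <= M.
  near (pinfty_nbhs R) => M; exists M; split; last by near: M.
  by near: M; apply: nbhs_pinfty_ge; rewrite num_real.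
exists M; split => // [t i j tab|eps e0]; first exact/bM/Kx.
have : \forall del \near 0^'+, forall i j p q, K p -> `|p - q| <= del ->
    `|space_jacobian p i j - space_jacobian q i j| <= eps.
  apply: filter_forall => i; apply: filter_forall => j.
  exact: compact_uniform_continuity.
apply: filterS => del H t d tab ddel.
have [B [BE BJ]] := mean_value_jacobian (x t) d t dv.
exists B; split => // i j; have [s s01 ->] := BJ i.
rewrite distrC; apply: H; first exact: Kx.
have -> : (x t, t) - (x t + s *: d, t) = (- (s *: d), 0) :> V * R.
  by apply/pair_equal_spec; split => /=; rewrite ?subrr// opprD addrA subrr sub0r.
rewrite prod_normE/= normr0 normrN normrZ.
move: s01; rewrite in_itv/= => /andP[s0 s1].
rewrite ge_max (le_trans _ ddel) ?ger0_norm ?ler_piMl//=.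
exact: le_trans ddel.
Unshelve. all: by end_near. Qed.

End Linearization.

(** * Differentiability of the flow map *)

Section FlowRegularity.
Context {R : realType} {n : nat}.
Local Notation V := 'cV[R]_n.
Variables (v : V -> R -> V) (t0 t1 : R) (F : R -> V -> V).
Hypotheses (vC1 : Ck 1 (fun p : V * R => v p.1 p.2)) (t01 : t0 < t1).
Hypothesis F_flow : flow_map v t0 t1 F.

Let flow_start x : F t0 x = x. Proof. by have [] := F_flow x. Qed.

Let t0_in : t0 \in `[t0, t1]. Proof. by rewrite in_itv/= lexx ltW. Qed.

Lemma flow_diff_continuous x d :
  {within `[t0, t1], continuous (fun t => F t (x + d) - F t x)}.
Proof.
move=> t; apply: (@continuousB R V (subspace `[t0, t1])).
  by have [_ c _] := F_flow (x + d); exact: c.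
by have [_ c _] := F_flow x; exact: c.
Qed.

Lemma flow_diff_derive x d t : t \in `]t0, t1[ ->
  is_derive t (1 : R) (fun s => F s (x + d) - F s x)
    (v (F t (x + d)) t - v (F t x) t).
Proof.
move=> tab; have [_ _ d1] := F_flow (x + d); have [_ _ d2] := F_flow x.
exact: (is_deriveB (d1 t tab) (d2 t tab)).
Qed.

(* The first time at which the trajectories are [r] apart is not reached: until
   then the Gronwall bound, which is below [r], applies. *)
Lemma flow_stability x : exists2 E, 0 < E & exists2 r, 0 < r &
  forall d, E * dotv d d < r ^+ 2 -> forall t, t \in `[t0, t1] ->
  dotv (F t (x + d) - F t x) (F t (x + d) - F t x) <= E * dotv d d.
Proof.
have [_ cx _] := F_flow x.
have [M [M0 JM lin]] := uniform_linearization vC1 cx.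
(* Accuracy 1 is enough here: it bounds the entries of the mean value matrices by [M + 1]. *)
have [r [r0 {lin}lin]] : exists r, 0 < r /\
    forall t d, t \in `[t0, t1] -> `|d| <= r ->
      exists B : 'M[R]_n, v (F t x + d) t - v (F t x) t = B *m d /\
        forall i j, `|B i j - space_jacobian v (F t x, t) i j| <= 1.
  near (0 : R)^'+ => r; exists r; split; first by near: r; exact: nbhs_right_gt.
  by near: r; exact: lin.
pose K := 2 * n%:R * (M + 1) + 1; pose E := expR (K * (t1 - t0)).
exists E; first exact: expR_gt0.
exists r => // d dr.
pose w t := F t (x + d) - F t x; pose f t := dotv (w t) (w t).
(* Conditional bound: closeness strictly before [s] already yields the Gronwall bound at [s] itself,
   with error term 0. *)
have fle s : s \in `[t0, t1] -> (forall t, t \in `]t0, s[ -> f t < r ^+ 2) ->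
    f s <= E * dotv d d.
  move=> sab fs; move: (sab); rewrite in_itv/= => /andP[t0s st1].
  have sub t : t \in `]t0, s[ -> t \in `]t0, t1[.
    by rewrite !in_itv/= => /andP[-> ts]/=; exact: lt_le_trans st1.
  have subc t : t \in `]t0, s[ -> t \in `[t0, t1].
    by move=> /sub; rewrite !in_itv/= => /andP[/ltW-> /ltW].
  have [B BP] : exists B : R -> 'M[R]_n, forall t, t \in `]t0, s[ ->
      v (F t (x + d)) t - v (F t x) t = B t *m w t /\
      forall i j, `|B t i j| <= M + 1.
    have /choice[B BP] : forall t, exists B : 'M[R]_n, t \in `]t0, s[ ->
        v (F t (x + d)) t - v (F t x) t = B *m w t /\
        forall i j, `|B i j| <= M + 1.
      move=> t; case: (boolP (t \in `]t0, s[)) => [ts|_]; last by exists 0.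
      have wr : `|w t| <= r.
        by apply: norm_le_of_dotv; [exact: ltW|exact/ltW/fs].
      have [B [BE BJ]] := lin t (w t) (subc t ts) wr.
      exists B => _; split=> [|i j].
        by rewrite -BE; congr (v _ _ - _); rewrite /w [RHS]addrC subrK.
      rewrite -(subrK (space_jacobian v (F t x, t) i j) (B i j)) addrC.
      by rewrite (le_trans (ler_normD _ _))// lerD// JM// subc.
    by exists B.
  have cw : {within `[t0, s], continuous w}.
    have st : `[t0, s] `<=` `[t0, t1] by apply: subset_itvl; rewrite bnd_simp.
    exact: (continuous_subspaceW st (@flow_diff_continuous x d)).
  have dw t : t \in `]t0, s[ -> is_derive t (1 : R) w (B t *m w t + 0).
    by move=> ts; rewrite addr0 -(BP t ts).1; exact/flow_diff_derive/sub.
  have := @energy_estimate _ _ t0 s w B (fun=> 0) (M + 1) 0 _ (lexx _) cw dw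
    (fun t i j ts => (BP t ts).2 i j) _ s t0.
  rewrite !in_itv/= !lexx !t0s expr0n/= mulr0 addr0.
  have -> : w t0 = d by rewrite /w !flow_start addrAC subrr add0r.
  move=> H; apply: le_trans (H _ _ _ _) _ => //.
  - by rewrite addr_ge0.
  - by move=> t i _; rewrite mxE normr0.
  - rewrite ler_wpM2r ?dotv_ge0// ler_expR ler_wpM2l ?lerB//.
    by rewrite addr_ge0// mulr_ge0// addr_ge0.
(* If [S] were nonempty, its infimum [s] would satisfy [f s < r ^+ 2] by [fle]; by continuity this
   persists near [s], whereas points of [S] lie arbitrarily close to [s]. *)
pose S := [set t | t \in `[t0, t1] /\ r ^+ 2 <= f t].
suff S0 t : t \in `[t0, t1] -> f t < r ^+ 2.
  move=> t tab; apply: fle => // u; rewrite !in_itv/= => /andP[u0 ut].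
  apply: S0; move: tab; rewrite !in_itv/= => /andP[_ tt1].
  by rewrite (ltW u0) (le_trans (ltW ut)).
move=> tab; rewrite ltNge; apply/negP => rf.
have St : S t by [].
have hS : has_inf S.
  by split; [exists t|exists t0 => u [] /[!in_itv]/= /andP[]].
pose s := inf S.
have sle u : S u -> s <= u by move=> Su; apply: ge_inf => //; exact: hS.2.
have sab : s \in `[t0, t1].
  rewrite in_itv/= lb_le_inf/=; [|by exists t|by move=> u [] /[!in_itv]/= /andP[]].
  by apply: le_trans (sle t St) _; move: tab; rewrite in_itv/= => /andP[].
have fs : f s < r ^+ 2.
  apply: le_lt_trans dr; apply: fle => // u; rewrite in_itv/= => /andP[u0 us].
  rewrite ltNge; apply/negP => rfu.
  have : s <= u.
    apply: sle; split => //; rewrite in_itv/= (ltW u0)/=.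
    by apply: le_trans (ltW us) _; move: sab; rewrite in_itv/= => /andP[].
  by rewrite leNgt us.
have cf : {within `[t0, t1], continuous f}.
  move=> u; apply: (@continuous_comp (subspace `[t0, t1]) _ _ w
     (fun w : V => dotv w w)); last exact: dotv_continuous.
  exact: flow_diff_continuous.
have : within `[t0, t1] (nbhs s) [set u | f u < r ^+ 2].
  by rewrite nbhs_subspace_in//; exact: (cvgr_lt _ (cf s) _ fs).
move=> /nbhs_normP[e /= e0 He].
have [u Su use] := inf_adherent e0 hS.
have su := sle u Su.
have : f u < r ^+ 2.
  apply: He; last exact: Su.1.
  by rewrite /= ler0_norm ?subr_le0// opprB ltrBlDl.
by rewrite ltNge Su.2.
Unshelve. all: by end_near. Qed.

(** [K] depends on the base point only. Steps and directions may vary with [k], which serves both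
    applications: two steps in one direction for the existence of derivatives, one step in all basis
    directions for their independence. *)
Lemma flow_quotients_estimate x : exists2 K, 0 < K &
  forall m (c : 'I_m -> R) eta, 0 < eta -> exists2 del, 0 < del &
  forall (h : 'I_m -> R) (e : 'I_m -> V),
  (forall k, h k != 0 /\ `|h k| < del) -> (forall k, dotv (e k) (e k) <= 1) ->
  let u t := \sum_k (c k / h k) *: (F t (h k *: e k + x) - F t x) in
  forall s t, s \in `[t0, t1] -> t \in `[t0, t1] ->
  dotv (u s) (u s) <= K * (dotv (u t) (u t) + eta).
Proof.
have [_ cx _] := F_flow x.
have [M [M0 JM lin]] := uniform_linearization vC1 cx.
have [E E0 [r r0 stab]] := flow_stability x.
exists (expR ((2 * n%:R * M + 1) * (t1 - t0))); first exact: expR_gt0.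
move=> m c eta eta0.
pose q := Num.sqrt E; have q0 : 0 < q by rewrite sqrtr_gt0.
have qE : q ^+ 2 = E by rewrite sqr_sqrtr// ltW.
pose S1 := n%:R * q * \sum_k `|c k|.
have S10 : 0 <= S1 by rewrite !mulr_ge0 ?sumr_ge0//; exact: ltW.
(* [eps * S1] will bound the entries of the error term; [eps] is chosen so that its contribution to
   the energy is at most [eta]. The added 1 keeps the denominator positive. *)
pose eps := Num.sqrt (eta / (n%:R * S1 ^+ 2 + 1)).
have den0 : 0 < n%:R * S1 ^+ 2 + 1 by rewrite ltr_wpDl// mulr_ge0// sqr_ge0.
have eps0 : 0 < eps by rewrite sqrtr_gt0 divr_gt0.
have epsS1 : n%:R * (eps * S1) ^+ 2 <= eta.
  rewrite exprMn sqr_sqrtr; last by rewrite divr_ge0// ltW.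
  rewrite mulrCA mulrAC -mulrA ler_piMr ?(ltW eta0)//.
  by rewrite ler_pdivrMr// mul1r lerDl.
have [rho [rho0 {lin}lin]] : exists rho, 0 < rho /\
    forall t d, t \in `[t0, t1] -> `|d| <= rho ->
      exists B : 'M[R]_n, v (F t x + d) t - v (F t x) t = B *m d /\
        forall i j, `|B i j - space_jacobian v (F t x, t) i j| <= eps.
  near (0 : R)^'+ => r'; exists r'; split; first by near: r'; exact: nbhs_right_gt.
  by near: r'; exact: lin.
(* This keeps [q * |h k|] below [r], where stability applies, and below [rho], where the
   linearisation has accuracy [eps]. *)
exists (Num.min r rho / q); first by rewrite divr_gt0// lt_min r0.
move=> h e hdel e1 u.
pose w k t := F t (h k *: e k + x) - F t x.
have qh k : q * `|h k| < r /\ q * `|h k| < rho.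
  have [_] := hdel k; rewrite ltr_pdivlMr// lt_min mulrC.
  by move=> /andP.
have hek k : E * dotv (h k *: e k) (h k *: e k) <= (q * `|h k|) ^+ 2.
  rewrite dotvZ exprMn qE real_normK ?num_real//.
  by rewrite ler_pM2l// ler_piMr// sqr_ge0.
have wle k t : t \in `[t0, t1] -> `|w k t| <= q * `|h k|.
  move=> tab; apply: norm_le_of_dotv; first by rewrite mulr_ge0// ltW.
  apply: le_trans (hek k); rewrite /w [h k *: e k + x]addrC; apply: stab => //.
  apply: le_lt_trans (hek k) _; rewrite ltr_pXn2r ?nnegrE ?mulr_ge0// ?ltW//.
  exact: (qh k).1.
have [B BP] : exists B : 'I_m -> R -> 'M[R]_n, forall k t, t \in `[t0, t1] ->
    v (F t (h k *: e k + x)) t - v (F t x) t = B k t *m w k t /\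
    forall i j, `|B k t i j - space_jacobian v (F t x, t) i j| <= eps.
  suff /choice[B BP] : forall k, exists B : R -> 'M[R]_n,
      forall t, t \in `[t0, t1] ->
      v (F t (h k *: e k + x)) t - v (F t x) t = B t *m w k t /\
      forall i j, `|B t i j - space_jacobian v (F t x, t) i j| <= eps.
    by exists B.
  move=> k; suff /choice[B BP] : forall t, exists B : 'M[R]_n, t \in `[t0, t1] ->
      v (F t (h k *: e k + x)) t - v (F t x) t = B *m w k t /\
      forall i j, `|B i j - space_jacobian v (F t x, t) i j| <= eps.
    by exists B.
  move=> t; case: (boolP (t \in `[t0, t1])) => [tab|_]; last by exists 0.
  have [|B [BE BJ]] := lin t (w k t) tab.
    by apply: le_trans (wle k t tab) _; exact/ltW/(qh k).2.
  exists B => _; split=> //.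
  by rewrite -BE; congr (v _ _ - _); rewrite /w [RHS]addrC subrK.
pose A t := space_jacobian v (F t x, t).
pose err t := \sum_k (c k / h k) *: ((B k t - A t) *m w k t).
have cw k : {within `[t0, t1], continuous (w k)}.
  have := @flow_diff_continuous x (h k *: e k).
  by rewrite addrC.
have cu : {within `[t0, t1], continuous u}.
  have := @continuous_big V 'I_m +%R 0 xpredT (@add_continuous V)
    (subspace `[t0, t1]) (index_enum _) (fun k t => (c k / h k) *: w k t).
  apply=> k _ t.
  apply: (@continuous_comp (subspace `[t0, t1]) _ _ (w k)
    (fun y : V => (c k / h k) *: y)); first exact: cw.
  exact: (continuousZl_tmp (@cvg_id _ _)).
have sub t : t \in `]t0, t1[ -> t \in `[t0, t1].
  by rewrite !in_itv/= => /andP[/ltW-> /ltW].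
have du t : t \in `]t0, t1[ -> is_derive t (1 : R) u (A t *m u t + err t).
  move=> tab.
  have dw k : is_derive t (1 : R) (w k) (B k t *m w k t).
    rewrite -(BP k t (sub t tab)).1.
    have := @flow_diff_derive x (h k *: e k) t tab.
    by rewrite [x + _]addrC.
  have dcw k := is_deriveZ (c k / h k) (dw k).
  have := is_derive_sum dcw.
  rewrite (_ : \sum_k _ = u); last by apply/funext => s; rewrite fct_sumE.
  move=> H; apply: is_derive_eq H _.
  rewrite /u mulmx_sumr /err -big_split/=; apply: eq_bigr => k _.
  by rewrite -scalemxAr -scalerDr -mulmxDl addrC subrK.
(* The stability bound on [w k] is proportional to [|h k|], which cancels the division by [h k] in
   the quotient. *)
have eerr t i : t \in `]t0, t1[ -> `|err t i 0| <= eps * S1.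
  move=> /sub tab; rewrite /err summxE.
  apply: le_trans (ler_norm_sum _ _ _) _.
  have -> : eps * S1 = \sum_k `|c k| * (n%:R * (eps * q)).
    by rewrite -mulr_suml /S1; ring.
  apply: ler_sum => k _; have [hk0 _] := hdel k.
  have hk : 0 < `|h k| by rewrite normr_gt0.
  rewrite !mxE normrM normf_div.
  apply: (@le_trans _ _ (`|c k| / `|h k| * (n%:R * (eps * (q * `|h k|))))).
    rewrite ler_wpM2l ?divr_ge0//.
    apply: le_trans (ler_norm_sum _ _ _) _.
    rewrite -[n in n%:R]card_ord mulr_natl -sumr_const.
    apply: ler_sum => j _; rewrite normrM ler_pM//.
      by rewrite !mxE; have := (BP k t tab).2 i j; rewrite !mxE.
    exact: le_trans (coord_le_norm _ _) (wle k t tab).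
  rewrite le_eqVlt; apply/orP; left; apply/eqP.
  by field; rewrite gt_eqF.
move=> s t sab tab.
have ES0 : 0 <= eps * S1 by rewrite mulr_ge0// ltW.
apply: le_trans (energy_estimate M0 ES0 cu du _ eerr sab tab) _.
  by move=> t' i j /sub; exact: JM.
by rewrite ler_wpM2l ?expR_ge0// lerD2l.
Unshelve. all: by end_near. Qed.

(** The estimate is applied with coefficients 1 and -1 to two quotients in the same direction. At
    [t0] both equal [e], so their difference vanishes there and is at most of squared length
    [K * eta] at time [t]: the quotients are Cauchy. *)
Lemma flow_derivable x e t : t \in `[t0, t1] -> dotv e e <= 1 ->
  derivable (F t) x e.
Proof.
move=> tab e1; have [K K0 HK] := flow_quotients_estimate x.
apply: cauchy_cvg; apply: cauchy_exP => eps eps0.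
pose eta := (eps / 2) ^+ 2 / K.
have eta0 : 0 < eta by rewrite divr_gt0 ?exprn_gt0// divr_gt0.
have [del del0 Hdel] :=
  HK _ (fun k : 'I_2 => if k == 0 then 1 else - 1) eta eta0.
set quo := (fun h : R => _).
exists (quo (del / 2)).
have del20 : 0 < del / 2 by rewrite divr_gt0.
suff : \forall h \near 0^', ball (quo (del / 2)) eps (quo h) by [].
near=> h; rewrite -ball_normE /ball_/=.
have hdel : h != 0 /\ `|h| < del.
  split; first by near: h; exact: nbhs_dnbhs_neq.
  by near: h; exact: dnbhs0_lt.
have h0del : del / 2 != 0 /\ `|del / 2| < del.
  split; first by rewrite gt_eqF.
  by rewrite gtr0_norm// ltr_pdivrMr// mulr_natr mulr2n ltrDl.
have := Hdel (fun k => if k == 0 then del / 2 else h) (fun=> e) _ (fun=> e1)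
  t t0 tab t0_in.
rewrite !big_ord_recl !big_ord0/= !flow_start !addrK !scalerA !addr0.
rewrite !mulfVK ?h0del.1 ?hdel.1// scaleN1r scale1r subrr.
rewrite {2}/dotv mulmx0 mxE add0r /eta [K * _]mulrC divfK ?gt_eqF// => H.
apply: (@le_lt_trans _ _ (eps / 2)).
  apply: norm_le_of_dotv; first by rewrite divr_ge0// ltW.
  rewrite /quo/= -scaleNr; apply: le_trans (H _).
    by rewrite mul1r mulN1r.
  by move=> k; case: ifP.
by rewrite ltr_pdivrMr// mulr_natr mulr2n ltrDl.
Unshelve. all: by end_near. Qed.

(** For a kernel vector [w] the combination of quotients with coefficients [w] tends to 0 at time
    [t], yet it equals [w] at [t0] for every step. The estimate run backwards from [t] to [t0] then
    forces [w] to vanish. *)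
Lemma flow_gradmx_unit x t : t \in `[t0, t1] -> gradmx (F t) x \in unitmx.
Proof.
move=> tab; rewrite unitmxE unitfE; apply/negP; rewrite -det_tr.
move=> /det0P[w w0 wG].
pose c k := w 0 k.
have N0 : 0 < dotv w^T w^T.
  rewrite lt_neqAle dotv_ge0 andbT eq_sym; apply: contra w0 => /eqP N0.
  apply/eqP/matrixP => i j; rewrite ord1 mxE.
  have := sqr_coord_le_dotv w^T j; rewrite N0 mxE => wj.
  by apply/eqP; rewrite -sqrf_eq0 eq_le wj sqr_ge0.
have e1 k : dotv (delta_mx k 0 : V) (delta_mx k 0) <= 1.
  by rewrite /dotv trmx_delta mul_delta_mx mxE !eqxx.
have [K K0 HK] := flow_quotients_estimate x.
(* With the energy at [t] below [eta], the estimate gives at most [K * (eta + eta)], half the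
   squared length of [w]. *)
pose eta := dotv w^T w^T / (4 * K).
have eta0 : 0 < eta by rewrite divr_gt0// mulr_gt0.
have [del del0 Hdel] := HK _ c eta eta0.
pose q k h := h^-1 *: ((F t \o shift x) (h *: (delta_mx k 0 : V)) - F t x).
have qcvg l : \sum_k c k *: 'D_(delta_mx k 0) (F t) x = l ->
    \sum_k c k *: q k h @[h --> 0^'] --> l.
  move=> <-.
  have qk k : c k *: q k h @[h --> 0^'] --> c k *: 'D_(delta_mx k 0) (F t) x.
    apply: (@cvgZl_tmp _ _ _ _ _ (c k) (q k)).
    exact: (@flow_derivable x _ t tab (e1 k)).
  exact: (@cvg_big V 'I_n +%R 0 xpredT (@add_continuous V) R (0 : R)^'
    (index_enum _) (fun k h => c k *: q k h)
    (fun k => c k *: 'D_(delta_mx k 0) (F t) x) _ (fun k _ => qk k)).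
have {}qcvg : \sum_k c k *: q k h @[h --> 0^'] --> (0 : V).
  apply: qcvg; transitivity ((w *m (gradmx (F t) x)^T)^T).
    apply/matrixP => i j; rewrite ord1 !mxE summxE.
    by apply: eq_bigr => k _; rewrite !mxE.
  by rewrite wG trmx0.
have dcvg : dotv (\sum_k c k *: q k h) (\sum_k c k *: q k h) @[h --> 0^'] --> 0.
  have d0 : dotv (0 : V) 0 = 0 by rewrite /dotv mulmx0 mxE.
  by have := continuous_cvg _ (@dotv_continuous R n 0) qcvg; rewrite d0; exact.
have [h [h0 hdel]] : exists h, [/\ h != 0, `|h| < del &
    dotv (\sum_k c k *: q k h) (\sum_k c k *: q k h) < eta].
  near (0 : R)^' => h; exists h; split.
  - by near: h; exact: nbhs_dnbhs_neq.
  - by near: h; exact: dnbhs0_lt.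
  - by near: h; exact: (cvgr_lt _ dcvg _ eta0).
have := Hdel (fun=> h) (fun k => delta_mx k 0) (fun=> conj h0 hdel) e1
  t0 t t0_in tab.
rewrite /=.
have -> : \sum_k (c k / h) *: (F t0 (h *: delta_mx k 0 + x) - F t0 x) = w^T.
  rewrite (matrix_sum_delta w^T); apply: eq_bigr => k _.
  by rewrite big_ord1 !flow_start addrK scalerA divfK// mxE.
have -> : \sum_k (c k / h) *: (F t (h *: delta_mx k 0 + x) - F t x) =
    \sum_k c k *: q k h.
  by apply: eq_bigr => k _; rewrite /q scalerA.
move=> H1 H2; suff : dotv w^T w^T <= dotv w^T w^T / 2 by lra.
apply: le_trans H1 _.
have -> : dotv w^T w^T / 2 = K * (eta + eta).
  by rewrite /eta; field; rewrite gt_eqF.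
by rewrite ler_pM2l// lerD2r ltW.
Unshelve. all: by end_near. Qed.

End FlowRegularity.

(** * Translation invariance of the surface integral *)

Section MeasurePreserving.
Context d (T : measurableType d) (R : realType).
Variable mu : {measure set T -> \bar R}.
Import HBNNSimple.

Section NnsfunComp.
Context (h : {nnsfun T >-> R}) (phi : T -> T).
Hypothesis mphi : measurable_fun [set: T] phi.

Definition nnsfun_comp_fun : T -> R := h \o phi.

Let comp_measurable : measurable_fun [set: T] nnsfun_comp_fun.
Proof. exact: measurableT_comp. Qed.

Let comp_finite : finite_set (range nnsfun_comp_fun).
Proof.
apply: (@sub_finite_set _ _ (range h)); last exact: fimfunP.
by move=> _ [x _ <-]; exists (phi x).
Qed.

Let comp_ge0 x : 0 <= nnsfun_comp_fun x.
Proof. exact: fun_ge0. Qed.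

HB.instance Definition _ :=
  isMeasurableFun.Build d _ T R nnsfun_comp_fun comp_measurable.
HB.instance Definition _ := FiniteImage.Build T R nnsfun_comp_fun comp_finite.
HB.instance Definition _ := isNonNegFun.Build T R nnsfun_comp_fun comp_ge0.

Definition nnsfun_comp : {nnsfun T >-> R} := nnsfun_comp_fun.

End NnsfunComp.

Local Open Scope ereal_scope.

(* The nonnegative integral of the library before any measurability is asked:
   neither the surface nor the integrand is known to be measurable. *)
Let nnint (f : T -> \bar R) := ereal_sup [set sintegral mu h |
  h in [set h : {nnsfun T >-> R} | forall x, (h x)%:E <= f x]].

(** Each simple function below [f] becomes, after composition with [phi], a simple function below
    [f \o phi] whose level sets have the same measure. *)
Let nnint_comp_ge (phi : T -> T) (f : T -> \bar R) :
  measurable_fun [set: T] phi -> (forall A, mu (phi @^-1` A) = mu A) ->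
  nnint f <= nnint (f \o phi).
Proof.
move=> mphi muphi; apply: ge_ereal_sup => _ [h hf <-].
apply: ereal_sup_ubound; exists (nnsfun_comp h mphi) => [x|]; first exact: hf.
rewrite /sintegral; apply: eq_fsbigr => r _; congr (_ * _).
exact: (muphi (h @^-1` [set r])).
Qed.

(** Invariance of [mu] is assumed on all sets, so it passes to the inverse [psi]; applying the
    one-sided comparison to [phi] and to [psi] gives equality. *)
Lemma integral_measure_preserving (phi psi : T -> T) (D : set T)
    (f : T -> \bar R) :
  cancel phi psi -> cancel psi phi ->
  measurable_fun [set: T] phi -> measurable_fun [set: T] psi ->
  (forall A, mu (phi @^-1` A) = mu A) ->
  \int[mu]_(x in phi @^-1` D) f (phi x) = \int[mu]_(x in D) f x.
Proof.
move=> phiK psiK mphi mpsi muphi.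
have mupsi A : mu (psi @^-1` A) = mu A.
  rewrite -(muphi (psi @^-1` A)); congr (mu _).
  by apply/seteqP; split => x; rewrite /preimage/= phiK.
have nnintE g : nnint (g \o phi) = nnint g.
  apply/eqP; rewrite eq_le nnint_comp_ge// andbT.
  rewrite [leRHS](_ : _ = nnint ((g \o phi) \o psi)); first exact: nnint_comp_ge.
  by congr nnint; apply/funext => x /=; rewrite psiK.
have restrictE : (fun x => f (phi x)) \_ (phi @^-1` D) = (f \_ D) \o phi.
  apply/funext => x; rewrite /patch/=.
  by congr (if _ then _ else _); apply/idP/idP; rewrite !inE.
rewrite /integral restrictE.
rewrite funepos_comp funeneg_comp; congr (_ - _)%E.
  exact: (nnintE ((f \_ D) ^\+)).
exact: (nnintE ((f \_ D) ^\-)).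
Qed.

End MeasurePreserving.

Section Translation.
Context {R : realType} {n : nat}.
Local Notation V := 'cV[R]_n.
Local Open Scope ereal_scope.

Lemma ediam_translate (c : V) (U : set V) :
  ediam [set (x + c)%R | x in U] = ediam U.
Proof.
rewrite /ediam; congr ereal_sup; apply/seteqP; split => z /= [[x y]].
  move=> [/= [x' Ux <-] [y' Uy <-]] <-; exists (x', y') => //=.
  by rewrite opprD addrACA subrr addr0.
move=> [/= Ux Uy] <-; exists (x + c, y + c)%R => /=.
  by split; [exists x|exists y].
by rewrite opprD addrACA subrr addr0.
Qed.

Lemma hausdorff_gauge_translate m (c : V) (U : set V) :
  hausdorff_gauge m [set (x + c)%R | x in U] = hausdorff_gauge m U.
Proof.
rewrite /hausdorff_gauge ediam_translate.
have -> // : ([set (x + c)%R | x in U] = set0) = (U = set0).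
by apply/propext; split=> [U0|->]; [exact: image_set0_set0 U0|exact: image_set0].
Qed.

(** A translated cover covers the translated set, with the same diameters and gauges. Translating
    back gives the converse. *)
Let hausdorff_translate_le m (c : V) (A : set V) :
  hausdorff m [set (x + c)%R | x in A] <= hausdorff m A.
Proof.
apply: ge_ereal_sup => _ [d d0 <-].
apply: le_trans (hausdorff_pre_le _ _ d0).
apply: le_ereal_inf_tmp => _ [U [AU dU] <-].
apply: ereal_inf_lbound; exists (fun k => [set (x + c)%R | x in U k]).
  split=> [_ [x Ax <-]|k]; last by rewrite ediam_translate.
  by have [k _ Ukx] := AU x Ax; exists k => //; exists x.
by apply: eq_eseriesr => k _; rewrite hausdorff_gauge_translate.
Qed.

Lemma translateK (c : V) (A : set V) :
  [set (x - c)%R | x in [set (x + c)%R | x in A]] = A.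
Proof.
rewrite image_comp [X in X @` A](_ : _ = id) ?image_id//.
by apply/funext => x /=; rewrite addrK.
Qed.

Lemma hausdorff_translate m (c : V) (A : set V) :
  hausdorff m [set (x + c)%R | x in A] = hausdorff m A.
Proof.
apply/eqP; rewrite eq_le hausdorff_translate_le/=.
by rewrite -[X in hausdorff m X <= _](translateK c) hausdorff_translate_le.
Qed.

Lemma translate_preimage (c : V) (A : set V) :
  (fun x : V => (x + c)%R) @^-1` A = [set (x - c)%R | x in A].
Proof.
apply/seteqP; split => [x Ax|_ [x Ax <-]]; last by rewrite /preimage/= subrK.
by exists (x + c)%R => //; rewrite addrK.
Qed.

Lemma area_preimage_translate (c : V) (A : set V) :
  area_outer ((fun x : V => (x + c)%R) @^-1` A) = area_outer A.
Proof. by rewrite translate_preimage; exact: hausdorff_translate. Qed.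

Local Notation T := (caratheodory_type (@area_outer R n)).

(** The Caratheodory splitting of [X] by the preimage of [A] is the splitting by [A] of [X]
    translated by [c], and translation preserves the outer measure. *)
Lemma measurable_translate (c : V) :
  measurable_fun [set: T] (fun x : T => ((x : V) + c)%R : T).
Proof.
move=> _ A mA; rewrite setTI.
suff : area_outer.-caratheodory ((fun x : V => (x + c)%R) @^-1` A) by [].
move=> X.
have := (mA : area_outer.-caratheodory A) ((fun x : V => (x - c)%R) @^-1` X).
rewrite area_preimage_translate => ->.
rewrite -(area_preimage_translate c (_ `&` A)).
rewrite -(area_preimage_translate c (_ `&` ~` A)).
by congr (_ + _); congr (area_outer _);
  apply/seteqP; split => x; rewrite /preimage/= ?addrK.
Qed.

End Translation.

(** * Change of frame *)

Section FrameChange.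
Context {R : realType} {n : nat}.
Local Notation V := 'cV[R]_n.

Lemma mulmx_continuous (P : 'M[R]_n) : continuous (fun u : V => P *m u).
Proof.
have -> : (fun u : V => P *m u) = fun u : V => \sum_j u j 0 *: col j P.
  apply/funext => u; apply/matrixP => i k; rewrite ord1 mxE summxE.
  by apply: eq_bigr => j _; rewrite !mxE mulrC.
apply: (@continuous_big V 'I_n +%R 0 xpredT (@add_continuous V)) => j _ u.
apply: (@continuousZr_tmp _ _ _ (fun w : V => w j 0)); exact: coord_continuous.
Qed.

(** Left multiplication by [P] is linear and continuous, hence commutes with the limit of difference
    quotients; the shifts only move the base point. *)
Lemma gradmx_observer (P : 'M[R]_n) (c d : V) (f G : V -> V) (y : V) :
  (forall z, G z = P *m (f (z + c) - d)) ->
  (forall j, derivable f (y + c) (delta_mx j 0)) ->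
  gradmx G y = P *m gradmx f (y + c).
Proof.
move=> GE df; apply/matrixP => i j; rewrite !mxE.
have -> : 'D_(delta_mx j 0) G y = P *m 'D_(delta_mx j 0) f (y + c).
  rewrite {1}/derive.
  have -> : (fun h : R => h^-1 *: ((G \o shift y) (h *: delta_mx j 0) - G y)) =
      (fun u : V => P *m u) \o (fun h : R => h^-1 *:
        ((f \o shift (y + c)) (h *: delta_mx j 0) - f (y + c))).
    apply/funext => h; rewrite /= !GE -scalemxAr -mulmxBr.
    by rewrite opprB subrKA addrA.
  apply/cvg_lim => //.
  exact: (continuous_cvg _ (@mulmx_continuous P _) (df j)).
by rewrite mxE; apply: eq_bigr => k _; rewrite mxE.
Qed.

Lemma rotation_mulmxT (A : 'M[R]_n) : rotation A -> A *m A^T = 1%:M.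
Proof. by move=> [AA _]; exact: mulmx1C. Qed.

Lemma mulmx1_invmx (A B : 'M[R]_n) : A *m B = 1%:M -> invmx A = B.
Proof.
move=> AB; have [uA _] := mulmx1_unit AB.
by rewrite -[invmx A]mulmx1 -AB mulKmx.
Qed.

Lemma transport_conj (A P D : 'M[R]_n) : A \in unitmx -> rotation P ->
  invmx (P^T *m A) *m (P^T *m D *m P) *m (invmx (P^T *m A))^T =
  invmx A *m D *m (invmx A)^T.
Proof.
move=> uA rP; have PPt := rotation_mulmxT rP.
have -> : invmx (P^T *m A) = invmx A *m P.
  apply: mulmx1_invmx; rewrite mulmxA -(mulmxA _ A) mulmxV// mulmx1.
  exact: rP.1.
rewrite trmx_mul !mulmxA -(mulmxA _ P P^T) PPt mulmx1.
by rewrite -(mulmxA _ P P^T) PPt mulmx1.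
Qed.

Lemma derive_shift (W : normedModType R) (g : V -> W) (b u : V) :
  'D_u (fun y => g (y + b)) = (fun y => 'D_u g (y + b)).
Proof.
apply/funext => y; rewrite /derive.
set q := (X in lim (X @ _)); set q' := (X in _ = lim (X @ _)).
by have -> : q = q' by apply/funext => h; rewrite /q /q' /= addrA.
Qed.

Lemma shift_continuous (b : V) : continuous (fun y : V => y + b).
Proof.
move=> y; apply: (@continuousD R V V id (fun=> b)); first exact: cvg_id.
exact: cst_continuous.
Qed.

Lemma Ck1_shift (g : V -> R) (b : V) : Ck 1 g -> Ck 1 (fun y => g (y + b)).
Proof.
move=> [dg cg]; split=> [y|u].
  exact: (@differentiable_comp _ _ _ _ (fun y : V => y + b) g).
rewrite derive_shift => y.
apply: (@continuous_comp _ _ _ (fun y : V => y + b) ('D_u g)).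
  exact: shift_continuous.
exact: cg.
Qed.

Lemma grad_shift (g : V -> R) (b y : V) :
  grad (fun y => g (y + b)) y = grad g (y + b).
Proof.
apply/matrixP => i j; rewrite !mxE.
exact: (congr1 (@^~ y) (derive_shift g b (delta_mx i 0))).
Qed.

(** Lets the normals of the surface and of its translate be compared with one and the same
    gradient. *)
Lemma defining_function_shift (M : set V) (p b : V) (g : V -> R) :
  defining_function M p g ->
  defining_function [set x - b | x in M] (p - b) (fun y => g (y + b)).
Proof.
move=> [g1 gp [h [h1 hp hM]]]; split; first exact: Ck1_shift.
  by rewrite grad_shift subrK.
exists (fun y => h (y + b)); split; first exact: Ck1_shift.
  by rewrite subrK !grad_shift subrK.
have : \forall x \near p - b,
    M (x + b) <-> g (x + b) = 0 /\ 0 <= h (x + b).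
  apply: (@shift_continuous b (p - b) [set x | M x <-> g x = 0 /\ 0 <= h x]).
  by rewrite subrK.
apply: filterS => y <-; split=> [[x Mx <-]|My]; first by rewrite subrK.
by exists (y + b) => //; rewrite addrK.
Qed.

Lemma enorm1_dotv (u : V) : enorm u = 1 -> dotv u u = 1.
Proof.
by rewrite /enorm => u1; rewrite -(sqr_sqrtr (dotv_ge0 u)) u1 expr1n.
Qed.

(** Unit length forces [c ^+ 2 = c' ^+ 2], and the quadratic form sees the factor only through its
    square. *)
Lemma quadratic_form_normal (A : 'M[R]_n) (g : V) (c c' : R) :
  enorm (c *: g) = 1 -> enorm (c' *: g) = 1 ->
  dotv (c *: g) (A *m (c *: g)) = dotv (c' *: g) (A *m (c' *: g)).
Proof.
move=> /enorm1_dotv + /enorm1_dotv; rewrite !dotvZ => cg c'g.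
have g0 : dotv g g != 0.
  by apply/eqP => g0; move: cg; rewrite g0 mulr0 => /eqP; rewrite eq_sym oner_eq0.
have cc : c ^+ 2 = c' ^+ 2 by apply: (mulIf g0); rewrite cg c'g.
have dZ (k : R) : dotv (k *: g) (A *m (k *: g)) = k ^+ 2 * dotv g (A *m g).
  rewrite -scalemxAr !dotvE mulr_sumr; apply: eq_bigr => i _.
  by rewrite !mxE; ring.
by rewrite !dZ cc.
Qed.

Lemma area_integral_translate (c : V) (M : set V) (f : V -> R) :
  \int[area_measure]_(y in [set x - c | x in M]) f (y + c) =
  \int[area_measure]_(x in M) f x.
Proof.
rewrite -translate_preimage /Rintegral; congr fine.
apply: (@integral_measure_preserving _ (caratheodory_type (@area_outer R n)) R
  area_measure (fun y : V => y + c) (fun y : V => y - c) M (EFin \o f)).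
- exact: addrK.
- exact: subrK.
- exact: measurable_translate.
- exact: measurable_translate.
- exact: area_preimage_translate.
Qed.

End FrameChange.

Lemma eq_entrywise_integral (R : realType) n (t0 t1 c : R) (A B : R -> 'M[R]_n) :
  (forall t, t \in `[t0, t1] -> A t = B t) ->
  c *: (\matrix_(i, j) \int[lebesgue_measure]_(t in `[t0, t1]) A t i j) =
  c *: (\matrix_(i, j) \int[lebesgue_measure]_(t in `[t0, t1]) B t i j)
    :> 'M[R]_n.
Proof.
move=> AB; apply: congr1; apply/matrixP => i j; rewrite [LHS]mxE [RHS]mxE.
by apply: eq_Rintegral => t; rewrite inE/= => tab; rewrite AB.
Qed.

Theorem mainTheorem5 (R : realType) (n : nat) (n_gt0 : (0 < n)%N)
  (t0 t1 : R) (t01 : t0 < t1)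
  (v : 'cV[R]_n -> R -> 'cV[R]_n)
  (v_smooth : smooth (fun p : 'cV[R]_n * R => v p.1 p.2))
  (v_incompressible : forall x t, divergence (fun z => v z t) x = 0)
  (F : R -> 'cV[R]_n -> 'cV[R]_n) (F_flow : flow_map v t0 t1 F)
  (D : 'cV[R]_n -> R -> 'M[R]_n) (D_posdef : forall x t, sym_posdef (D x t))
  (Q : R -> 'M[R]_n) (Q_smooth : smooth Q) (Q_rot : forall t, rotation (Q t))
  (Q_t0 : Q t0 = 1%:M)
  (b : R -> 'cV[R]_n) (b_smooth : smooth b)
  (Dy : 'cV[R]_n -> R -> 'M[R]_n)
  (DyE : forall y t, Dy y t = (Q t)^T *m D (Q t *m y + b t) t *m Q t)
  (Fy : R -> 'cV[R]_n -> 'cV[R]_n)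
  (FyE : forall t, t \in `[t0, t1] ->
     forall x0 y0, x0 = y0 + b t0 -> F t x0 = Q t *m Fy t y0 + b t) :
  (forall x0 y0, x0 = y0 + b t0 ->
     (forall t, t \in `[t0, t1] ->
        transport_tensor F D t x0 = transport_tensor Fy Dy t y0) /\
     avg_transport_tensor F D t0 t1 x0 = avg_transport_tensor Fy Dy t0 t1 y0) /\
  (forall (M0 : set 'cV[R]_n) (nu nuy : 'cV[R]_n -> 'cV[R]_n),
     hypersurface M0 -> unit_normal M0 nu ->
     unit_normal [set x - b t0 | x in M0] nuy ->
     transport_functional F D t0 t1 M0 nu =
     transport_functional Fy Dy t0 t1 [set x - b t0 | x in M0] nuy).
Proof.
have transportE x0 y0 t : x0 = y0 + b t0 -> t \in `[t0, t1] ->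
    transport_tensor F D t x0 = transport_tensor Fy Dy t y0.
  move=> -> tab; rewrite /transport_tensor DyE -(FyE t tab _ _ erefl).
  (* Solving the conjugacy for [Fy] puts it in the form required by [gradmx_observer], with [P] the
     transpose of [Q t]. *)
  have FyF z : Fy t z = (Q t)^T *m (F t (z + b t0) - b t).
    by rewrite (FyE t tab _ _ erefl) addrK mulmxA (Q_rot t).1 mul1mx.
  have C1 := v_smooth 1%N.
  rewrite (gradmx_observer FyF) => [|j].
    by rewrite transport_conj//; exact: (flow_gradmx_unit C1 t01 F_flow).
  apply: (flow_derivable C1 t01 F_flow tab).
  by rewrite /dotv trmx_delta mul_delta_mx mxE !eqxx.
have avgE x0 y0 : x0 = y0 + b t0 ->
    avg_transport_tensor F D t0 t1 x0 = avg_transport_tensor Fy Dy t0 t1 y0.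
  move=> xy.
  exact: (@eq_entrywise_integral R n t0 t1 (t1 - t0)^-1
    (fun t => transport_tensor F D t x0)
    (fun t => transport_tensor Fy Dy t y0) (fun t => @transportE x0 y0 t xy)).
split=> [x0 y0 xy|M nu nuy hM nuM nuyM].
  by split=> [t|]; [exact: transportE|exact: avgE].
rewrite /transport_functional; congr (_ / _); last first.
  exact/esym/(area_integral_translate (b t0) M (fun=> 1)).
(* The numerator is moved to the translated surface, where the integrands are compared pointwise. *)
rewrite -(area_integral_translate (b t0)) /Rintegral; congr fine.
apply: eq_integral => y; rewrite inE/= => -[x Mx <-]; congr EFin.
rewrite subrK (avgE x (x - b t0)) ?subrK//.
have [g gM] := hM x Mx.
have [nu1 /(_ g gM)[c nuc]] := nuM x Mx.
have My : [set x - b t0 | x in M] (x - b t0) by exists x.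
have [nuy1 /(_ _ (defining_function_shift (b t0) gM))[c']] := nuyM _ My.
rewrite grad_shift subrK => nuyc'.
move: nu1 nuy1; rewrite nuc nuyc'.
exact: quadratic_form_normal.
Qed.
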